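(* Let $\pi=\pi_{12}\frac{\partial}{\partial x}\wedge\frac{\partial}{\partial y}+\pi_{13}\frac{\partial}{\partial x}\wedge\frac{\partial}{\partial z}+\pi_{23}\frac{\partial}{\partial y}\wedge\frac{\partial}{\partial z}$ be a (smooth) Poisson tensor on $\mathbb{R}^3$. Then $\pi$ is compatible with the canonical metric $\langle\cdot,\cdot\rangle$ of $\mathbb{R}^3$ if and only if there exists a function $f\in C^\infty(\mathbb{R}^3)$ such that $$\pi_{12}=\frac{\partial f}{\partial z},\qquad \pi_{13}=-\frac{\partial f}{\partial y},\qquad \pi_{23}=\frac{\partial f}{\partial x},$$ and $$d\big(\langle df,df\rangle\big)-\Delta(f)\,df=0,$$ where $\Delta=\frac{\partial^2}{\partial x^2}+\frac{\partial^2}{\partial y^2}+\frac{\partial^2}{\partial z^2}$ is the usual Laplacian on $\mathbb{R}^3$. Moreover, the function $f$ is a Casimir function of $\pi$.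
   Context: The canonical metric of $\mathbb{R}^3$ is regarded as a contravariant metric, i.e. as the scalar product on $T^*\mathbb{R}^3$ with $\langle dx,dx\rangle=\langle dy,dy\rangle=\langle dz,dz\rangle=1$ and $\langle dx,dy\rangle=\langle dx,dz\rangle=\langle dy,dz\rangle=0$. Let $P$ be a manifold with Poisson tensor $\pi$, and let $\langle\cdot,\cdot\rangle$ be a Riemannian metric on $T^*P$ (a smooth symmetric contravariant 2-form that is a scalar product on each $T_x^*P$). The bundle map $\pi:T^*P\to TP$ is given by $\beta[\pi(\alpha)]=\pi(\alpha,\beta)$. The bracket on 1-forms is $[\alpha,\beta]_\pi=L_{\pi(\alpha)}\beta-L_{\pi(\beta)}\alpha-d(\pi(\alpha,\beta))$. The Levi-Civita contravariant connection $D$ associated with $(\pi,\langle\cdot,\cdot\rangle)$ is defined, for all $\alpha,\beta,\gamma\in\Omega^1(P)$, by $$2\langle D_\alpha\beta,\gamma\rangle=\pi(\alpha).\langle\beta,\gamma\rangle+\pi(\beta).\langle\alpha,\gamma\rangle-\pi(\gamma).\langle\alpha,\beta\rangle+\langle[\alpha,\beta]_\pi,\gamma\rangle+\langle[\gamma,\alpha]_\pi,\beta\rangle+\langle[\gamma,\beta]_\pi,\alpha\rangle,$$ where $X.g$ denotes the derivative of the function $g$ along the vector field $X$. The Poisson tensor $\pi$ and the metric $\langle\cdot,\cdot\rangle$ are called compatible if for all $\alpha,\beta,\gamma\in\Omega^1(P)$, $$D\pi(\alpha,\beta,\gamma):=\pi(\alpha).\pi(\beta,\gamma)-\pi(D_\alpha\beta,\gamma)-\pi(\beta,D_\alpha\gamma)=0.$$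 A Casimir function of $\pi$ is a function $f$ with $\pi(df)=0$. In coordinates, $\pi_{12}=\pi(dx,dy)$, $\pi_{13}=\pi(dx,dz)$, $\pi_{23}=\pi(dy,dz)$. *)

(* Defs.v *)
From Stdlib Require Import Reals.
From Coquelicot Require Import Coquelicot.
Open Scope R_scope.

(** * Calculus on R^3 *)

Definition R3 : Type := (R * R * R)%type.

Inductive coord : Set := cx | cy | cz.

Definition sum3 (F : coord -> R) : R := F cx + F cy + F cz.

Definition kron (i j : coord) : R :=
  match i, j with
  | cx, cx | cy, cy | cz, cz => 1
  | _, _ => 0
  end.

Definition proj (i : coord) (p : R3) : R :=
  match p, i with
  | (x, _, _), cx => x
  | (_, y, _), cy => y
  | (_, _, z), cz => z
  end.

(** [upd i p t] is the point [p] with its [i]-th coordinate replaced by [t]. *)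
Definition upd (i : coord) (p : R3) (t : R) : R3 :=
  match p, i with
  | (_, y, z), cx => (t, y, z)
  | (x, _, z), cy => (x, t, z)
  | (x, y, _), cz => (x, y, t)
  end.

Definition scalar_field := R3 -> R.

Definition ex_partial (i : coord) (f : scalar_field) (p : R3) : Prop :=
  ex_derive (fun t => f (upd i p t)) (proj i p).

Definition partial (i : coord) (f : scalar_field) : scalar_field :=
  fun p => Derive (fun t => f (upd i p t)) (proj i p).

(** The existence of the partial derivatives is required explicitly because
    [Derive], hence [partial], is a total operator. *)
Fixpoint class_C (n : nat) (f : scalar_field) : Prop :=
  (forall p : R3, continuous f p) /\
  match n with
  | O => True
  | S m => forall i, (forall p, ex_partial i f p) /\ class_C m (partial i f)
  end.

Definition smooth (f : scalar_field) : Prop := forall n, class_C n f.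

Definition laplacian (f : scalar_field) : scalar_field :=
  fun p => sum3 (fun i => partial i (partial i f) p).

(** * Tensor fields, given by their components in the coordinates (x, y, z) *)

Definition vector_field := R3 -> coord -> R.
Definition one_form := R3 -> coord -> R.

(** A contravariant 2-tensor field [T] is given by
    [T p i j] = T(dx_i, dx_j)(p), where dx_i is [dcoord i]. *)
Definition tensor2 := R3 -> coord -> coord -> R.

Definition smooth_form (a : one_form) : Prop :=
  forall i, smooth (fun p => a p i).

Definition smooth_tensor2 (T : tensor2) : Prop :=
  forall i j, smooth (fun p => T p i j).

Definition dcoord (i : coord) : one_form := fun _ j => kron i j.

Definition d (f : scalar_field) : one_form := fun p i => partial i f p.

Definition pairing (b : one_form) (X : vector_field) : scalar_field :=
  fun p => sum3 (fun i => b p i * X p i).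

Definition deriv_along (X : vector_field) (f : scalar_field) : scalar_field :=
  pairing (d f) X.

Definition eval2 (T : tensor2) (a b : one_form) : scalar_field :=
  fun p => sum3 (fun i => sum3 (fun j => T p i j * a p i * b p j)).

(** The bundle map T*R^3 -> TR^3 of a contravariant 2-tensor, characterized by
    b[T(a)] = T(a, b); see [sharpE]. *)
Definition sharp (T : tensor2) (a : one_form) : vector_field :=
  fun p i => eval2 T a (dcoord i) p.

Lemma sharpE (T : tensor2) (a b : one_form) (p : R3) :
  pairing b (sharp T a) p = eval2 T a b p.
Proof.
unfold pairing, sharp, eval2, sum3, dcoord, kron; ring.
Qed.

(** (L_X b)_i = X.b_i + sum_j b_j * (d X^j / d x_i) *)
Definition lie_derivative (X : vector_field) (b : one_form) : one_form :=
  fun p i => deriv_along X (fun q => b q i) p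
             + sum3 (fun j => b p j * partial i (fun q => X q j) p).

Definition partial_field (i : coord) : vector_field := fun _ j => kron i j.

Definition wedge (X Y : vector_field) : tensor2 :=
  fun p i j => X p i * Y p j - X p j * Y p i.

(** p12 d/dx /\ d/dy + p13 d/dx /\ d/dz + p23 d/dy /\ d/dz *)
Definition bivector (p12 p13 p23 : scalar_field) : tensor2 :=
  fun p i j =>
      p12 p * wedge (partial_field cx) (partial_field cy) p i j
    + p13 p * wedge (partial_field cx) (partial_field cz) p i j
    + p23 p * wedge (partial_field cy) (partial_field cz) p i j.

Lemma bivectorE (p12 p13 p23 : scalar_field) (p : R3) :
  eval2 (bivector p12 p13 p23) (dcoord cx) (dcoord cy) p = p12 p /\
  eval2 (bivector p12 p13 p23) (dcoord cx) (dcoord cz) p = p13 p /\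
  eval2 (bivector p12 p13 p23) (dcoord cy) (dcoord cz) p = p23 p.
Proof.
unfold eval2, bivector, wedge, partial_field, dcoord, sum3; simpl.
repeat split; ring.
Qed.

(** The canonical metric of R^3, as a scalar product on T*R^3. *)
Definition canonical_metric : tensor2 := fun _ i j => kron i j.

(** * Poisson tensors and compatible metrics *)

Definition poisson_bracket (pi : tensor2) (f g : scalar_field) : scalar_field :=
  eval2 pi (d f) (d g).

Definition jacobi (pi : tensor2) : Prop :=
  forall f g h : scalar_field, smooth f -> smooth g -> smooth h ->
  forall p,
    poisson_bracket pi f (poisson_bracket pi g h) p
    + poisson_bracket pi g (poisson_bracket pi h f) p
    + poisson_bracket pi h (poisson_bracket pi f g) p = 0.

Definition poisson_tensor (pi : tensor2) : Prop :=
  smooth_tensor2 pi /\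
  (forall p i j, pi p i j = - pi p j i) /\
  jacobi pi.

Definition casimir (pi : tensor2) (f : scalar_field) : Prop :=
  forall p i, sharp pi (d f) p i = 0.

Definition form_bracket (pi : tensor2) (a b : one_form) : one_form :=
  fun p i => lie_derivative (sharp pi a) b p i
             - lie_derivative (sharp pi b) a p i
             - d (eval2 pi a b) p i.

(** [D] is the Levi-Civita contravariant connection of [(pi, g)]. Since [g] is
    nondegenerate on each fibre, the Koszul formula determines [D] on smooth
    1-forms; its values on other arguments are irrelevant. *)
Definition levi_civita (pi g : tensor2)
    (D : one_form -> one_form -> one_form) : Prop :=
  (forall a b, smooth_form a -> smooth_form b -> smooth_form (D a b)) /\
  (forall a b c, smooth_form a -> smooth_form b -> smooth_form c ->
   forall p,
     2 * eval2 g (D a b) c p =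
       deriv_along (sharp pi a) (eval2 g b c) p
     + deriv_along (sharp pi b) (eval2 g a c) p
     - deriv_along (sharp pi c) (eval2 g a b) p
     + eval2 g (form_bracket pi a b) c p
     + eval2 g (form_bracket pi c a) b p
     + eval2 g (form_bracket pi c b) a p).

Definition cov_deriv (D : one_form -> one_form -> one_form) (pi : tensor2)
    (a b c : one_form) : scalar_field :=
  fun p => deriv_along (sharp pi a) (eval2 pi b c) p
           - eval2 pi (D a b) c p - eval2 pi b (D a c) p.

Definition compatible (pi g : tensor2) : Prop :=
  exists D, levi_civita pi g D /\
    forall a b c, smooth_form a -> smooth_form b -> smooth_form c ->
    forall p, cov_deriv D pi a b c p = 0.

(* Main.v *)
Require Import Defs.
From Stdlib Require Import Reals Lra FunctionalExtensionality.
From Coquelicot Require Import Coquelicot.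
Open Scope R_scope.

(** The bivectors on R^3 correspond to the 1-forms [b], through
    [pi(a, c) = b . (a x c)]; [b = d f] is the form of [pi] in the theorem.
    On coordinate forms Koszul's formula gives
    [2 <D_dxi dxj, dxk> = d_k pi_ij + d_j pi_ki + d_i pi_kj], and
    substituting this, compatibility with the metric reads
    [b_j R_ik - b_k R_ij + (delta_ij G_k - delta_ik G_j) / 2 = 0], where
    [R_jk = d_j b_k - d_k b_j] and [G = 2 sum_i b_i d b_i - (div b) b].
    Linear combinations of these equations give [|b|^2 R = 0], hence [R = 0]
    since [b] vanishes near every point where [R] does not, and then [G = 0].
    A closed form is some [d f] by the Poincaré lemma, and then [G] is
    [d <df, df> - (Delta f) df]. *)

(** * Replacement of coordinates and continuity on R^3 *)

Lemma upd_proj (i : coord) (p : R3) : upd i p (proj i p) = p.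
Proof. now destruct p as [[x y] z], i. Qed.

Lemma proj_upd (i : coord) (p : R3) (t : R) : proj i (upd i p t) = t.
Proof. now destruct p as [[x y] z], i. Qed.

Lemma upd_upd (i : coord) (p : R3) (s t : R) :
  upd i (upd i p s) t = upd i p t.
Proof. now destruct p as [[x y] z], i. Qed.

Lemma proj_upd_neq (i j : coord) (p : R3) (t : R) :
  i <> j -> proj i (upd j p t) = proj i p.
Proof. now destruct p as [[x y] z], i, j. Qed.

Lemma upd_upd_neq (i j : coord) (p : R3) (s t : R) :
  i <> j -> upd i (upd j p s) t = upd j (upd i p t) s.
Proof. now destruct p as [[x y] z], i, j. Qed.

Lemma continuous_triple (U : UniformSpace) (X Y Z : U -> R) (w : U) :
  continuous X w -> continuous Y w -> continuous Z w ->
  continuous (fun v => ((X v, Y v), Z v) : R3) w.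
Proof.
intros cX cY cZ.
apply (continuous_comp_2 (fun v => (X v, Y v)) Z (fun a b => (a, b))); trivial.
  apply (continuous_comp_2 X Y (fun a b => (a, b))); trivial.
  apply continuous_ext with (f := fun v => v); [now intros []|apply continuous_id].
apply continuous_ext with (f := fun v => v); [now intros []|apply continuous_id].
Qed.

Lemma continuous_proj (i : coord) (p : R3) : continuous (proj i) p.
Proof.
destruct p as [[x y] z]; destruct i.
- apply continuous_ext with (f := fun q : R3 => fst (fst q));
    [now intros [[a b] c]|].
  apply (continuous_comp fst fst); apply continuous_fst.
- apply continuous_ext with (f := fun q : R3 => snd (fst q));
    [now intros [[a b] c]|].
  apply (continuous_comp fst snd); [apply continuous_fst|apply continuous_snd].
- apply continuous_ext with (f := fun q : R3 => snd q);
    [now intros [[a b] c]|apply continuous_snd].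
Qed.

Lemma continuous_upd (U : UniformSpace) (i : coord) (P : U -> R3) (T : U -> R)
    (w : U) :
  continuous P w -> continuous T w -> continuous (fun v => upd i (P v) (T v)) w.
Proof.
intros cP cT.
assert (cj : forall j, continuous (fun v => proj j (P v)) w).
  intros j; apply (continuous_comp P (proj j)); trivial; apply continuous_proj.
apply continuous_ext with (f := fun v =>
  ((match i with cx => T v | _ => proj cx (P v) end,
    match i with cy => T v | _ => proj cy (P v) end),
    match i with cz => T v | _ => proj cz (P v) end) : R3).
  intros v; now destruct (P v) as [[x y] z], i.
destruct i; apply continuous_triple; auto.
Qed.

(** * Smooth functions on R^3 *)

Lemma ex_partial_plus (i : coord) (F G : scalar_field) (p : R3) :
  ex_partial i F p -> ex_partial i G p -> ex_partial i (fun q => F q + G q) p.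
Proof.
intros dF dG.
exact (ex_derive_plus (fun t => F (upd i p t)) (fun t => G (upd i p t)) _ dF dG).
Qed.

Lemma ex_partial_mult (i : coord) (F G : scalar_field) (p : R3) :
  ex_partial i F p -> ex_partial i G p -> ex_partial i (fun q => F q * G q) p.
Proof. unfold ex_partial; intros dF dG; now apply ex_derive_mult. Qed.

Lemma partial_plus_ex (i : coord) (F G : scalar_field) (p : R3) :
  ex_partial i F p -> ex_partial i G p ->
  partial i (fun q => F q + G q) p = partial i F p + partial i G p.
Proof.
intros dF dG.
exact (Derive_plus (fun t => F (upd i p t)) (fun t => G (upd i p t)) _ dF dG).
Qed.

Lemma partial_mult_ex (i : coord) (F G : scalar_field) (p : R3) :
  ex_partial i F p -> ex_partial i G p ->
  partial i (fun q => F q * G q) p = partial i F p * G p + F p * partial i G p.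
Proof.
intros dF dG; unfold partial at 1; rewrite Derive_mult by trivial.
now rewrite upd_proj.
Qed.

Lemma partial_const (i : coord) (c : R) (p : R3) : partial i (fun _ => c) p = 0.
Proof. exact (Derive_const c _). Qed.

Lemma class_C_continuous (n : nat) (F : scalar_field) (p : R3) :
  class_C n F -> continuous F p.
Proof. destruct n; intros [c _]; apply c. Qed.

(** Needed for products: Leibniz's rule puts [F] and [G] themselves next to their derivatives, which
    are one order less regular. *)
Lemma class_CS (n : nat) (F : scalar_field) : class_C (S n) F -> class_C n F.
Proof.
revert F; induction n as [|n IH]; intros F CF.
  split; [intros p; exact (class_C_continuous _ _ p CF)|trivial].
destruct CF as [cF dF]; split; trivial.
intros i; destruct (dF i) as [eF CdF]; split; auto.
Qed.

Lemma class_C_plus (n : nat) (F G : scalar_field) :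
  class_C n F -> class_C n G -> class_C n (fun p => F p + G p).
Proof.
revert F G; induction n as [|n IH]; intros F G [cF dF] [cG dG]; split; trivial.
- intros p; exact (continuous_plus F G p (cF p) (cG p)).
- intros p; exact (continuous_plus F G p (cF p) (cG p)).
- intros i; destruct (dF i) as [eF CF], (dG i) as [eG CG]; split.
    intros p; now apply ex_partial_plus.
  replace (partial i (fun p => F p + G p))
    with (fun p => partial i F p + partial i G p); auto.
  extensionality p; now rewrite partial_plus_ex.
Qed.

Lemma class_C_mult (n : nat) (F G : scalar_field) :
  class_C n F -> class_C n G -> class_C n (fun p => F p * G p).
Proof.
revert F G; induction n as [|n IH]; intros F G CF CG.
  split; trivial; intros p.
  exact (continuous_mult F G p (proj1 CF p) (proj1 CG p)).
split.
  intros p; exact (continuous_mult F G p (proj1 CF p) (proj1 CG p)).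
intros i; destruct (proj2 CF i) as [eF CdF], (proj2 CG i) as [eG CdG]; split.
  intros p; now apply ex_partial_mult.
replace (partial i (fun p => F p * G p))
  with (fun p => partial i F p * G p + F p * partial i G p).
  apply class_CS in CF; apply class_CS in CG.
  apply class_C_plus; auto.
extensionality p; now rewrite partial_mult_ex.
Qed.

Lemma smooth_const (c : R) : smooth (fun _ => c).
Proof.
intros n; revert c; induction n as [|n IH]; intros c; split; trivial.
- intros p; apply continuous_const.
- intros p; apply continuous_const.
- intros i; split; [intros p; exact (ex_derive_const c _)|].
  replace (partial i (fun _ => c)) with (fun _ : R3 => 0); trivial.
  extensionality p; symmetry; apply partial_const.
Qed.

Lemma smooth_plus (F G : scalar_field) :
  smooth F -> smooth G -> smooth (fun p => F p + G p).
Proof. intros sF sG n; now apply class_C_plus. Qed.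

Lemma smooth_mult (F G : scalar_field) :
  smooth F -> smooth G -> smooth (fun p => F p * G p).
Proof. intros sF sG n; now apply class_C_mult. Qed.

Lemma smooth_opp (F : scalar_field) : smooth F -> smooth (fun p => - F p).
Proof.
intros sF.
replace (fun p => - F p) with (fun p => (-1) * F p).
  now apply smooth_mult; [apply smooth_const|].
extensionality p; ring.
Qed.

Lemma smooth_sum3 (F : coord -> scalar_field) :
  (forall i, smooth (F i)) -> smooth (fun p => sum3 (fun i => F i p)).
Proof. intros sF; unfold sum3; now repeat apply smooth_plus. Qed.

Lemma smooth_partial (i : coord) (F : scalar_field) :
  smooth F -> smooth (partial i F).
Proof. intros sF n; exact (proj2 (proj2 (sF (S n)) i)). Qed.

Lemma smooth_ex_partial (i : coord) (F : scalar_field) (p : R3) :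
  smooth F -> ex_partial i F p.
Proof. intros sF; exact (proj1 (proj2 (sF 1%nat) i) p). Qed.

Lemma smooth_continuous (F : scalar_field) (p : R3) : smooth F -> continuous F p.
Proof. intros sF; exact (proj1 (sF 0%nat) p). Qed.

Lemma partial_mult (i : coord) (F G : scalar_field) (p : R3) :
  smooth F -> smooth G ->
  partial i (fun q => F q * G q) p = partial i F p * G p + F p * partial i G p.
Proof. intros sF sG; apply partial_mult_ex; now apply smooth_ex_partial. Qed.

Lemma partial_opp (i : coord) (F : scalar_field) (p : R3) :
  partial i (fun q => - F q) p = - partial i F p.
Proof. exact (Derive_opp (fun t => F (upd i p t)) _). Qed.

Lemma partial_sum3 (i : coord) (F : coord -> scalar_field) (p : R3) :
  (forall j, smooth (F j)) ->
  partial i (fun q => sum3 (fun j => F j q)) p = sum3 (fun j => partial i (F j) p).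
Proof.
intros sF; unfold sum3.
assert (eF : forall j, ex_partial i (F j) p)
  by (intros j; now apply smooth_ex_partial).
rewrite (partial_plus_ex i (fun q => F cx q + F cy q) (F cz)); trivial;
  [rewrite partial_plus_ex; trivial|now apply ex_partial_plus].
Qed.

(** [partial] differentiates a slice only at the point's own coordinate. Since [upd i p t] has the
    same [i]-slice as [p], this extends to every [t]. *)
Lemma is_derive_partial (i : coord) (F : scalar_field) (p : R3) (t : R) :
  smooth F -> is_derive (fun s => F (upd i p s)) t (partial i F (upd i p t)).
Proof.
intros sF.
assert (e := smooth_ex_partial i F (upd i p t) sF).
apply Derive_correct in e.
unfold partial; rewrite proj_upd in *.
apply is_derive_ext with (f := fun s => F (upd i (upd i p t) s)); trivial.
now intros s; rewrite upd_upd.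
Qed.

Lemma continuous_slice (i : coord) (F : scalar_field) (p : R3) (t : R) :
  smooth F -> continuous (fun s => F (upd i p s)) t.
Proof.
intros sF; apply (continuous_comp (fun s => upd i p s) F).
  apply continuous_upd; [apply continuous_const|apply continuous_id].
now apply smooth_continuous.
Qed.

Lemma continuity_2d_slice (i j : coord) (F : scalar_field) (p : R3) (s t : R) :
  smooth F -> continuity_2d_pt (fun u v => F (upd j (upd i p u) v)) s t.
Proof.
intros sF; apply continuity_2d_pt_filterlim.
apply (continuous_comp (fun z : R * R => upd j (upd i p (fst z)) (snd z)) F).
  apply continuous_upd; [apply continuous_upd|].
  - apply continuous_const.
  - apply continuous_fst.
  - apply continuous_snd.
now apply smooth_continuous.
Qed.

(** Schwarz's theorem on the two-dimensional slice through [p] in the directions [i] and [j]. *)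
Lemma partial_comm (i j : coord) (F : scalar_field) (p : R3) :
  smooth F -> partial i (partial j F) p = partial j (partial i F) p.
Proof.
intros sF.
assert (dec : {i = j} + {i <> j}) by decide equality.
destruct dec as [<-|ij]; trivial.
assert (ji : j <> i) by congruence.
(* The next four facts translate simple and iterated [Derive] on the slice into [partial]. Where [i]
   is differentiated, the two replacements are swapped first, so that the moving coordinate is the
   outer one. *)
assert (Dj : forall q u v,
    Derive (fun t => F (upd j (upd i q u) t)) v = partial j F (upd j (upd i q u) v)).
  intros q u v; apply is_derive_unique; now apply is_derive_partial.
assert (Di : forall q u v,
    Derive (fun t => F (upd j (upd i q t) v)) u = partial i F (upd j (upd i q u) v)).
  intros q u v; rewrite <- (upd_upd_neq i j) by trivial.
  rewrite <- (is_derive_unique _ _ _ (is_derive_partial i F _ u sF)).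
  now apply Derive_ext; intros t; rewrite upd_upd_neq.
assert (Dij : forall u v,
    Derive (fun z => Derive (fun t => F (upd j (upd i p z) t)) v) u
    = partial i (partial j F) (upd j (upd i p u) v)).
  intros u v; rewrite <- (upd_upd_neq i j) by trivial.
  rewrite <- (is_derive_unique _ _ _
    (is_derive_partial i (partial j F) _ u (smooth_partial j F sF))).
  now apply Derive_ext; intros t; rewrite Dj, upd_upd_neq.
assert (Dji : forall u v,
    Derive (fun z => Derive (fun t => F (upd j (upd i p t) z)) u) v
    = partial j (partial i F) (upd j (upd i p u) v)).
  intros u v.
  rewrite <- (is_derive_unique _ _ _
    (is_derive_partial j (partial i F) _ v (smooth_partial i F sF))).
  now apply Derive_ext; intros t; rewrite Di.
assert (E := Schwarz (fun u v => F (upd j (upd i p u) v)) (proj i p) (proj j p)).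
rewrite Dij, Dji, !upd_proj in E.
apply E; clear E.
- apply locally_2d_forall; intros u v; repeat split.
  + apply ex_derive_ext with (f := fun z => F (upd i (upd j p v) z)).
      now intros t; rewrite upd_upd_neq.
    eexists; now apply is_derive_partial.
  + eexists; now apply is_derive_partial.
  + apply ex_derive_ext with (f := fun z => partial j F (upd i (upd j p v) z)).
      now intros t; rewrite Dj, upd_upd_neq.
    eexists; apply is_derive_partial; now apply smooth_partial.
  + apply ex_derive_ext with (f := fun z => partial i F (upd j (upd i p u) z)).
      now intros t; rewrite Di.
    eexists; apply is_derive_partial; now apply smooth_partial.
- apply continuity_2d_pt_ext
    with (f := fun u v => partial i (partial j F) (upd j (upd i p u) v)).
    now intros u v; rewrite Dij.
  apply continuity_2d_slice; now repeat apply smooth_partial.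
- apply continuity_2d_pt_ext
    with (f := fun u v => partial j (partial i F) (upd j (upd i p u) v)).
    now intros u v; rewrite Dji.
  apply continuity_2d_slice; now repeat apply smooth_partial.
Qed.

(** Mere existence of partial derivatives does not give joint continuity. Here they are continuous,
    hence bounded near [p] by a common [D], and the mean value inequality along three segments
    parallel to the axes bounds the increment of [f]. *)
Lemma continuous_of_partial (f : scalar_field) (B : coord -> scalar_field) :
  (forall i p, is_derive (fun t => f (upd i p t)) (proj i p) (B i p)) ->
  (forall i p, continuous (B i) p) -> forall p, continuous f p.
Proof.
intros df cB [[x y] z].
assert (step : forall i q s D,
    (forall t, Rabs (t - proj i q) <= Rabs (s - proj i q) ->
               Rabs (B i (upd i q t)) <= D) ->
    Rabs (f (upd i q s) - f q) <= D * Rabs (s - proj i q)).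
  intros i q s D bB.
  rewrite <- (upd_proj i q) at 2.
  apply (bounded_variation (fun t => f (upd i q t)) (fun t => B i (upd i q t))).
  intros t Ht; split; [|now apply bB].
  assert (H := df i (upd i q t)); rewrite proj_upd in H.
  now apply is_derive_ext with (2 := H); intros u; rewrite upd_upd.
pose (p := ((x, y), z) : R3).
(* The summand 1 leaves room for each [B i] to vary by less than 1 around its value at [p]. *)
pose (D := 1 + sum3 (fun i => Rabs (B i p))).
assert (bD : forall i, Rabs (B i p) + 1 <= D).
  assert (H := fun i => Rabs_pos (B i p)).
  assert (Hx := H cx); assert (Hy := H cy); assert (Hz := H cz).
  unfold D, sum3; intros []; lra.
assert (D1 : 1 <= D).
  assert (H := bD cx); assert (H' := Rabs_pos (B cx p)); lra.
assert (bB : forall i, locally p (fun q => Rabs (B i q) <= D)).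
  intros i.
  assert (C := proj1 (filterlim_locally _ _) (cB i p) (mkposreal 1 Rlt_0_1)).
  apply filter_imp with (2 := C); intros q; simpl.
  change (Rabs (B i q - B i p) < 1 -> Rabs (B i q) <= D); intros Hq.
  assert (T := Rabs_triang (B i q - B i p) (B i p)).
  replace (B i q - B i p + B i p) with (B i q) in T by ring.
  assert (H := bD i); lra.
assert (bB3 : locally p (fun q => forall i, Rabs (B i q) <= D)).
  apply filter_imp with (2 := filter_and _ _ (bB cx) (filter_and _ _ (bB cy) (bB cz))).
  now intros q [H1 [H2 H3]] [].
destruct bB3 as [e He].
apply filterlim_locally; intros eps.
(* The radius [e] keeps the three segments where the bound [D] holds; [eps / (3 * D)] makes each
   segment contribute less than [eps / 3]. *)
assert (e0 : 0 < Rmin e (eps / (3 * D))).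
  apply Rmin_pos; [apply cond_pos|].
  apply Rdiv_lt_0_compat; [apply cond_pos|lra].
exists (mkposreal _ e0); intros [[x' y'] z'] [[Hx Hy] Hz]; simpl in Hx, Hy, Hz.
change (Rabs (x' - x) < Rmin e (eps / (3 * D))) in Hx.
change (Rabs (y' - y) < Rmin e (eps / (3 * D))) in Hy.
change (Rabs (z' - z) < Rmin e (eps / (3 * D))) in Hz.
assert (le := Rmin_l e (eps / (3 * D))).
assert (leps := Rmin_r e (eps / (3 * D))).
assert (near : forall u v w, Rabs (u - x) < e -> Rabs (v - y) < e ->
    Rabs (w - z) < e -> forall i, Rabs (B i ((u, v), w)) <= D).
  intros u v w Hu Hv Hw; apply He; now repeat split.
assert (Z : forall u, Rabs (u - u) < e).
  intros u; rewrite Rminus_diag, Rabs_R0; apply cond_pos.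
change (Rabs (f ((x', y'), z') - f ((x, y), z)) < eps).
(* The path goes from [(x, y, z)] to [(x, y, z')], then to [(x, y', z')], then to [(x', y', z')]. *)
assert (Sx := step cx ((x, y'), z') x' D); simpl in Sx.
assert (Sy := step cy ((x, y), z') y' D); simpl in Sy.
assert (Sz := step cz ((x, y), z) z' D); simpl in Sz.
replace (f ((x', y'), z') - f ((x, y), z)) with
  ((f ((x', y'), z') - f ((x, y'), z')) + (f ((x, y'), z') - f ((x, y), z'))
   + (f ((x, y), z') - f ((x, y), z))) by ring.
eapply Rle_lt_trans; [apply Rabs_triang|].
eapply Rle_lt_trans; [apply Rplus_le_compat_r, Rabs_triang|].
assert (m : D * Rmin e (eps / (3 * D)) <= eps / 3).
  replace (eps / 3) with (D * (eps / (3 * D))) by (field; lra).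
  apply Rmult_le_compat_l; lra.
assert (mx := Rmult_lt_compat_l D _ _ ltac:(lra) Hx).
assert (my := Rmult_lt_compat_l D _ _ ltac:(lra) Hy).
assert (mz := Rmult_lt_compat_l D _ _ ltac:(lra) Hz).
assert (Rabs (f ((x', y'), z') - f ((x, y'), z')) <= D * Rabs (x' - x)).
  apply Sx; intros t Ht; apply near; trivial; lra.
assert (Rabs (f ((x, y'), z') - f ((x, y), z')) <= D * Rabs (y' - y)).
  apply Sy; intros t Ht; apply near; trivial; lra.
assert (Rabs (f ((x, y), z') - f ((x, y), z)) <= D * Rabs (z' - z)).
  apply Sz; intros t Ht; apply near; trivial; lra.
lra.
Qed.

(** The partial derivatives of [f] are the [B i], smooth to all orders, so only the continuity of
    [f] itself has to be proved. *)
Lemma smooth_of_partial (f : scalar_field) (B : coord -> scalar_field) :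
  (forall i p, is_derive (fun t => f (upd i p t)) (proj i p) (B i p)) ->
  (forall i, smooth (B i)) -> smooth f.
Proof.
intros df sB.
assert (cf : forall p, continuous f p).
  apply (continuous_of_partial f B); trivial.
  intros i p; now apply smooth_continuous.
intros [|n]; split; trivial; intros i; split.
  intros p; eexists; apply df.
replace (partial i f) with (B i); [apply sB|].
extensionality p; symmetry; apply is_derive_unique, df.
Qed.

(** * The Poincaré lemma for 1-forms *)

Definition line_primitive (j : coord) (F : scalar_field) : scalar_field :=
  fun p => RInt (fun t => F (upd j p t)) 0 (proj j p).

Lemma is_derive_line_primitive (j : coord) (F : scalar_field) (p : R3) :
  smooth F ->
  is_derive (fun t => line_primitive j F (upd j p t)) (proj j p) (F p).
Proof.
intros sF; rewrite <- (upd_proj j p) at 2.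
apply is_derive_ext with (f := fun s => RInt (fun t => F (upd j p t)) 0 s).
  intros s; unfold line_primitive; rewrite proj_upd.
  now apply RInt_ext; intros t _; rewrite upd_upd.
apply (is_derive_RInt (fun t => F (upd j p t)) _ 0).
  apply filter_forall; intros s; apply (RInt_correct (fun t => F (upd j p t))).
  apply (ex_RInt_continuous (fun t => F (upd j p t))).
  intros t _; now apply continuous_slice.
now apply continuous_slice.
Qed.

(** Differentiation under the integral sign gives the integral of [partial i F]. By the closedness
    hypothesis this is the integral of [partial j G] in the variable [j], hence an increment of
    [G]. *)
Lemma is_derive_line_primitive_neq (i j : coord) (F G : scalar_field) (p : R3) :
  i <> j -> smooth F -> smooth G ->
  (forall q, partial i F q = partial j G q) ->
  is_derive (fun t => line_primitive j F (upd i p t)) (proj i p)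
    (G p - G (upd j p 0)).
Proof.
intros ij sF sG FG.
assert (D : forall s t, is_derive (fun u => F (upd j (upd i p u) t)) s
                          (partial j G (upd j (upd i p s) t))).
  intros s t; rewrite <- FG, <- (upd_upd_neq i j) by trivial.
  apply is_derive_ext with (f := fun u => F (upd i (upd j p t) u)).
    now intros u; rewrite upd_upd_neq.
  now apply is_derive_partial.
apply is_derive_ext
  with (f := fun s => RInt (fun t => F (upd j (upd i p s) t)) 0 (proj j p)).
  intros s; unfold line_primitive; now rewrite proj_upd_neq by congruence.
replace (G p - G (upd j p 0)) with
  (RInt (fun t => Derive (fun u => F (upd j (upd i p u) t)) (proj i p))
     0 (proj j p)).
  apply is_derive_RInt_param.
  - apply filter_forall; intros s t _; eexists; apply D.
  - intros t _; apply continuity_2d_pt_ext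
      with (f := fun u v => partial j G (upd j (upd i p u) v)).
      now intros u v; symmetry; apply is_derive_unique.
    now apply continuity_2d_slice, smooth_partial.
  - apply filter_forall; intros s.
    apply (ex_RInt_continuous (fun t => F (upd j (upd i p s) t))).
    intros t _; now apply continuous_slice.
rewrite (RInt_ext _ (Derive (fun t => G (upd j p t)))).
  rewrite RInt_Derive.
  - now rewrite upd_proj.
  - intros t _; eexists; now apply is_derive_partial.
  - intros t _; apply continuous_ext with (f := fun t => partial j G (upd j p t)).
      now intros u; symmetry; apply is_derive_unique, is_derive_partial.
    now apply continuous_slice, smooth_partial.
intros t _; rewrite (is_derive_unique _ _ _ (D _ _)), upd_proj.
symmetry; now apply is_derive_unique, is_derive_partial.
Qed.

Lemma poincare (b : one_form) :
  smooth_form b ->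
  (forall i j p, partial i (fun q => b q j) p = partial j (fun q => b q i) p) ->
  exists f, smooth f /\ forall p i, d f p i = b p i.
Proof.
intros sb cb.
pose (B := fun i q => b q i).
(* The integral of [b] along the broken path from the origin to [(x, 0, 0)], [(x, y, 0)] and
   [(x, y, z)]. *)
pose (f := fun p => line_primitive cz (B cz) p
  + line_primitive cy (B cy) (upd cz p 0)
  + line_primitive cx (B cx) (upd cy (upd cz p 0) 0)).
assert (df : forall i p, is_derive (fun t => f (upd i p t)) (proj i p) (B i p)).
  intros i [[x y] z]; unfold f; destruct i.
  (* The derivatives of the three legs telescope to the component of [b] at the endpoint; legs that
     do not involve the coordinate contribute [zero]. The nested [plus] follows the shape of [f]. *)
  - replace (B cx (x, y, z)) with
      (plus (plus (B cx (x, y, z) - B cx (x, y, 0))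
         (B cx (x, y, 0) - B cx (x, 0, 0))) (B cx (x, 0, 0)))
      by (unfold plus; simpl; ring).
    apply @is_derive_plus; [apply @is_derive_plus|].
    + apply (is_derive_line_primitive_neq cx cz (B cz) (B cx) (x, y, z));
        try apply sb; [easy|intros q; apply cb].
    + apply (is_derive_line_primitive_neq cx cy (B cy) (B cx) (x, y, 0));
        try apply sb; [easy|intros q; apply cb].
    + apply (is_derive_line_primitive cx (B cx) (x, 0, 0)), sb.
  - replace (B cy (x, y, z)) with
      (plus (plus (B cy (x, y, z) - B cy (x, y, 0)) (B cy (x, y, 0))) zero)
      by (unfold plus, zero; simpl; ring).
    apply @is_derive_plus; [apply @is_derive_plus|].
    + apply (is_derive_line_primitive_neq cy cz (B cz) (B cy) (x, y, z));
        try apply sb; [easy|intros q; apply cb].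
    + apply (is_derive_line_primitive cy (B cy) (x, y, 0)), sb.
    + apply (is_derive_const (line_primitive cx (B cx) (x, 0, 0))).
  - replace (B cz (x, y, z)) with (plus (plus (B cz (x, y, z)) zero) zero)
      by (unfold plus, zero; simpl; ring).
    apply @is_derive_plus; [apply @is_derive_plus|].
    + apply (is_derive_line_primitive cz (B cz) (x, y, z)), sb.
    + apply (is_derive_const (line_primitive cy (B cy) (x, y, 0))).
    + apply (is_derive_const (line_primitive cx (B cx) (x, 0, 0))).
exists f; split.
  exact (smooth_of_partial f B df sb).
intros p i; apply is_derive_unique, df.
Qed.

(** * The Levi-Civita contravariant connection of the canonical metric *)

Lemma deriv_along_mult (X : vector_field) (F G : scalar_field) (p : R3) :
  smooth F -> smooth G ->
  deriv_along X (fun q => F q * G q) p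
  = deriv_along X F p * G p + F p * deriv_along X G p.
Proof.
intros sF sG; unfold deriv_along, pairing, d, sum3.
rewrite !partial_mult by trivial; ring.
Qed.

Lemma deriv_along_sum3 (X : vector_field) (F : coord -> scalar_field) (p : R3) :
  (forall i, smooth (F i)) ->
  deriv_along X (fun q => sum3 (fun i => F i q)) p
  = sum3 (fun i => deriv_along X (F i) p).
Proof.
intros sF; unfold deriv_along, pairing, d; unfold sum3 at 1.
rewrite !partial_sum3 by trivial; unfold sum3; ring.
Qed.

Lemma eval2_canonical (a b : one_form) (p : R3) :
  eval2 canonical_metric a b p = sum3 (fun i => a p i * b p i).
Proof. unfold eval2, canonical_metric, sum3, kron; ring. Qed.

Lemma deriv_along_canonical (X : vector_field) (a b : one_form) (p : R3) :
  smooth_form a -> smooth_form b ->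
  deriv_along X (eval2 canonical_metric a b) p
  = sum3 (fun i => deriv_along X (fun q => a q i) p * b p i
                   + a p i * deriv_along X (fun q => b q i) p).
Proof.
intros sa sb.
replace (eval2 canonical_metric a b) with (fun q => sum3 (fun i => a q i * b q i)).
  rewrite (deriv_along_sum3 X (fun i q => a q i * b q i)).
    unfold sum3; now rewrite !deriv_along_mult.
  intros i; now apply smooth_mult.
now extensionality q; rewrite eval2_canonical.
Qed.

Lemma smooth_eval2 (T : tensor2) (a b : one_form) :
  smooth_tensor2 T -> smooth_form a -> smooth_form b -> smooth (eval2 T a b).
Proof.
intros sT sa sb; unfold eval2.
apply (smooth_sum3 (fun i q => sum3 (fun j => T q i j * a q i * b q j))); intros i.
apply (smooth_sum3 (fun j q => T q i j * a q i * b q j)); intros j.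
repeat apply smooth_mult; auto; apply sT.
Qed.

Lemma deriv_along_eval2 (X : vector_field) (T : tensor2) (a b : one_form) (p : R3) :
  smooth_tensor2 T -> smooth_form a -> smooth_form b ->
  deriv_along X (eval2 T a b) p
  = sum3 (fun i => sum3 (fun j =>
      deriv_along X (fun q => T q i j) p * a p i * b p j
      + T p i j * deriv_along X (fun q => a q i) p * b p j
      + T p i j * a p i * deriv_along X (fun q => b q j) p)).
Proof.
intros sT sa sb.
assert (s1 : forall i j, smooth (fun q => T q i j * a q i)).
  intros i j; apply smooth_mult; [apply sT|apply sa].
assert (s2 : forall i j, smooth (fun q => T q i j * a q i * b q j)).
  intros i j; apply smooth_mult; [apply s1|apply sb].
unfold eval2.
rewrite (deriv_along_sum3 X (fun i q => sum3 (fun j => T q i j * a q i * b q j))).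
  assert (E : forall i,
    deriv_along X (fun q => sum3 (fun j => T q i j * a q i * b q j)) p
    = sum3 (fun j => deriv_along X (fun q => T q i j) p * a p i * b p j
      + T p i j * deriv_along X (fun q => a q i) p * b p j
      + T p i j * a p i * deriv_along X (fun q => b q j) p)).
    intros i.
    rewrite (deriv_along_sum3 X (fun j q => T q i j * a q i * b q j)) by apply s2.
    unfold sum3.
    rewrite !(fun j => deriv_along_mult X _ _ p (s1 i j) (sb j)).
    rewrite !(fun j => deriv_along_mult X _ _ p (sT i j) (sa i)).
    ring.
  unfold sum3 at 1; rewrite !E; reflexivity.
intros i; now apply (smooth_sum3 (fun j q => T q i j * a q i * b q j)).
Qed.

Lemma smooth_dcoord (i : coord) : smooth_form (dcoord i).
Proof. intros j; exact (smooth_const (kron i j)). Qed.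

Lemma sharp_sum3 (T : tensor2) (a : one_form) (p : R3) (i : coord) :
  sharp T a p i = sum3 (fun j => T p j i * a p j).
Proof.
unfold sharp, eval2, dcoord, sum3, kron; destruct i; ring.
Qed.

Lemma deriv_along_partial_field (i : coord) (F : scalar_field) (p : R3) :
  deriv_along (partial_field i) F p = partial i F p.
Proof.
unfold deriv_along, pairing, partial_field, d, sum3, kron; destruct i; ring.
Qed.

(** * Antisymmetric tensors and the bracket of 1-forms *)

Definition antisymmetric (T : tensor2) : Prop := forall p i j, T p i j = - T p j i.

Lemma antisymmetric_diag (T : tensor2) (p : R3) (i : coord) :
  antisymmetric T -> T p i i = 0.
Proof. intros aT; assert (H := aT p i i); lra. Qed.

Lemma antisymmetric_partial (T : tensor2) (l : coord) :
  antisymmetric T -> antisymmetric (fun p i j => partial l (fun q => T q i j) p).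
Proof.
intros aT p i j; rewrite <- partial_opp; f_equal.
extensionality q; apply aT.
Qed.

(** By antisymmetry the two Lie derivatives together produce the term in the derivative of [T] twice
    and the terms in the [k]-derivatives of [a] and [b] once. Subtracting [d (eval2 T a b)] leaves
    one copy of the former and none of the latter. *)
Lemma form_bracketE (T : tensor2) (a b : one_form) (p : R3) (k : coord) :
  smooth_tensor2 T -> antisymmetric T -> smooth_form a -> smooth_form b ->
  form_bracket T a b p k
  = deriv_along (sharp T a) (fun q => b q k) p
    - deriv_along (sharp T b) (fun q => a q k) p
    + sum3 (fun i => sum3 (fun j => partial k (fun q => T q i j) p * a p i * b p j)).
Proof.
intros sT aT sa sb.
assert (ds : forall c j, smooth_form c ->
    partial k (fun q => sharp T c q j) p
    = sum3 (fun i => partial k (fun q => T q i j) p * c p i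
                     + T p i j * partial k (fun q => c q i) p)).
  intros c j sc.
  replace (fun q => sharp T c q j) with (fun q => sum3 (fun i => T q i j * c q i))
    by now extensionality q; rewrite sharp_sum3.
  rewrite (partial_sum3 k (fun i q => T q i j * c q i)).
    unfold sum3; rewrite !(fun i => partial_mult k _ _ p (sT i j) (sc i)); ring.
  intros i; apply smooth_mult; [apply sT|apply sc].
assert (de : d (eval2 T a b) p k = deriv_along (partial_field k) (eval2 T a b) p)
  by now rewrite deriv_along_partial_field.
unfold form_bracket, lie_derivative; rewrite de, deriv_along_eval2 by trivial.
unfold sum3; rewrite !deriv_along_partial_field, !ds by trivial; unfold sum3.
(* [T] and its derivative are reduced to their three independent entries, so that [ring] sees the
   antisymmetry. *)
assert (aT' := antisymmetric_partial T k aT p); simpl in aT'.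
assert (dT' := fun i => antisymmetric_diag _ p i (antisymmetric_partial T k aT)).
simpl in dT'; rewrite !dT', !(antisymmetric_diag T p) by trivial.
rewrite (aT p cy cx), (aT p cz cx), (aT p cz cy).
rewrite (aT' cy cx), (aT' cz cx), (aT' cz cy).
ring.
Qed.

(** The component along [dcoord k] of the derivative of [dcoord j] in the direction [dcoord i]. The
    metric is constant on coordinate forms, so only the three brackets of Koszul's formula
    contribute. *)
Definition christoffel (T : tensor2) (p : R3) (i j k : coord) : R :=
  (partial k (fun q => T q i j) p + partial j (fun q => T q k i) p
   + partial i (fun q => T q k j) p) / 2.

Definition connection (T : tensor2) (a b : one_form) : one_form := fun p k =>
  deriv_along (sharp T a) (fun q => b q k) p
  + sum3 (fun i => sum3 (fun j => christoffel T p i j k * a p i * b p j)).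

Definition koszul (T : tensor2) (a b c : one_form) : scalar_field := fun p =>
  deriv_along (sharp T a) (eval2 canonical_metric b c) p
  + deriv_along (sharp T b) (eval2 canonical_metric a c) p
  - deriv_along (sharp T c) (eval2 canonical_metric a b) p
  + eval2 canonical_metric (form_bracket T a b) c p
  + eval2 canonical_metric (form_bracket T c a) b p
  + eval2 canonical_metric (form_bracket T c b) a p.

(** In components, the derivatives of [a] and [c] cancel between the metric terms and the brackets,
    and those of [b] along [sharp T a] add up to twice the first term of [connection]; what remains
    are the symbols [christoffel]. *)
Lemma koszul_connection (T : tensor2) (a b c : one_form) (p : R3) :
  smooth_tensor2 T -> antisymmetric T ->
  smooth_form a -> smooth_form b -> smooth_form c ->
  2 * eval2 canonical_metric (connection T a b) c p = koszul T a b c p.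
Proof.
intros sT aT sa sb sc; unfold koszul.
rewrite !deriv_along_canonical by trivial.
rewrite !eval2_canonical; unfold sum3.
rewrite !form_bracketE by trivial.
unfold connection, christoffel, sum3; field.
Qed.

Lemma smooth_connection (T : tensor2) (a b : one_form) :
  smooth_tensor2 T -> smooth_form a -> smooth_form b ->
  smooth_form (connection T a b).
Proof.
intros sT sa sb k; unfold connection.
apply smooth_plus.
  unfold deriv_along, pairing, d.
  apply (smooth_sum3 (fun i q => partial i (fun q0 => b q0 k) q * sharp T a q i)).
  intros i; apply smooth_mult; [apply smooth_partial, sb|].
  now apply smooth_eval2; [| |apply smooth_dcoord].
apply (smooth_sum3 (fun i q => sum3 (fun j => christoffel T q i j k * a q i * b q j))).
intros i.
apply (smooth_sum3 (fun j q => christoffel T q i j k * a q i * b q j)); intros j.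
apply smooth_mult; [apply smooth_mult; [|apply sa]|apply sb].
unfold christoffel, Rdiv; apply smooth_mult; [|apply smooth_const].
repeat apply smooth_plus; apply smooth_partial, sT.
Qed.

Lemma levi_civita_connection (T : tensor2) :
  smooth_tensor2 T -> antisymmetric T ->
  levi_civita T canonical_metric (connection T).
Proof.
intros sT aT; split.
  intros a b sa sb; now apply smooth_connection.
intros a b c sa sb sc p; now apply koszul_connection.
Qed.

(** The coordinate forms are orthonormal, so Koszul's formula with third argument [dcoord k]
    determines the [k]-th component. *)
Lemma levi_civita_unique (T : tensor2) (D : one_form -> one_form -> one_form)
    (a b : one_form) (p : R3) (k : coord) :
  smooth_tensor2 T -> antisymmetric T -> levi_civita T canonical_metric D ->
  smooth_form a -> smooth_form b -> D a b p k = connection T a b p k.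
Proof.
intros sT aT [_ HD] sa sb.
assert (E : forall c : one_form,
    eval2 canonical_metric c (dcoord k) p = c p k).
  intros c; rewrite eval2_canonical.
  unfold dcoord, sum3, kron; destruct k; ring.
assert (H := HD a b (dcoord k) sa sb (smooth_dcoord k) p).
assert (K := koszul_connection T a b (dcoord k) p sT aT sa sb (smooth_dcoord k)).
unfold koszul in K; rewrite <- K, !E in H; lra.
Qed.

(** The value of [cov_deriv (connection T) T] on the coordinate forms of indices [i], [j], [k]. *)
Definition cov_deriv_coef (T : tensor2) (p : R3) (i j k : coord) : R :=
  sum3 (fun l => T p i l * partial l (fun q => T q j k) p
                 - christoffel T p i j l * T p l k
                 - christoffel T p i k l * T p j l).

(** The covariant derivative of [T] is tensorial: the derivatives of [b] and [c] coming from
    [eval2 T b c] cancel against those in [connection]. *)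
Lemma cov_deriv_connection (T : tensor2) (a b c : one_form) (p : R3) :
  smooth_tensor2 T -> smooth_form a -> smooth_form b -> smooth_form c ->
  cov_deriv (connection T) T a b c p
  = sum3 (fun i => sum3 (fun j => sum3 (fun k =>
      cov_deriv_coef T p i j k * a p i * b p j * c p k))).
Proof.
intros sT sa sb sc; unfold cov_deriv.
rewrite deriv_along_eval2 by trivial.
assert (E : forall j k, deriv_along (sharp T a) (fun q => T q j k) p
    = sum3 (fun i => sum3 (fun l => T p i l * partial l (fun q => T q j k) p * a p i))).
  intros j k; unfold deriv_along, pairing, d, sum3.
  rewrite !sharp_sum3; unfold sum3; ring.
unfold eval2, cov_deriv_coef, connection, sum3; rewrite !E; unfold sum3.
ring.
Qed.

(** Uniqueness replaces any Levi-Civita connection by the explicit one, and tensoriality reduces the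
    condition to coordinate forms. *)
Lemma compatible_canonical (T : tensor2) :
  smooth_tensor2 T -> antisymmetric T ->
  compatible T canonical_metric <->
  (forall p i j k, cov_deriv_coef T p i j k = 0).
Proof.
intros sT aT; split.
  intros [D [LD CD]] p i j k.
  assert (H := CD _ _ _ (smooth_dcoord i) (smooth_dcoord j) (smooth_dcoord k) p).
  assert (K : cov_deriv (connection T) T (dcoord i) (dcoord j) (dcoord k) p = 0).
    rewrite <- H; unfold cov_deriv, eval2, sum3.
    now rewrite !(levi_civita_unique T D) by (trivial; apply smooth_dcoord).
  rewrite cov_deriv_connection in K by (trivial; apply smooth_dcoord).
  rewrite <- K; unfold dcoord, sum3, kron; destruct i, j, k; ring.
intros H; exists (connection T); split.
  now apply levi_civita_connection.
intros a b c sa sb sc p; rewrite cov_deriv_connection by trivial.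
unfold sum3; rewrite !H; ring.
Qed.

(** * Bivectors as 1-forms *)

(** The contraction of the 1-form [b] into d/dx /\ d/dy /\ d/dz: for [b = d f]
    these are the components of [pi] in the theorem. *)
Definition axial (b : one_form) : tensor2 :=
  bivector (fun p => b p cz) (fun p => - b p cy) (fun p => b p cx).

(** A table in the covector alone, so that it serves both for [b] and, by linearity, for its partial
    derivatives. *)
Definition axial_coef (u : coord -> R) (i j : coord) : R :=
  match i, j with
  | cx, cy => u cz | cy, cx => - u cz
  | cx, cz => - u cy | cz, cx => u cy
  | cy, cz => u cx | cz, cy => - u cx
  | _, _ => 0
  end.

Lemma axialE (b : one_form) (p : R3) (i j : coord) :
  axial b p i j = axial_coef (b p) i j.
Proof.
unfold axial, bivector, wedge, partial_field; destruct i, j; simpl; ring.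
Qed.

Lemma partial_axial (b : one_form) (p : R3) (l i j : coord) :
  partial l (fun q => axial b q i j) p
  = axial_coef (fun m => partial l (fun q => b q m) p) i j.
Proof.
replace (fun q => axial b q i j) with (fun q => axial_coef (b q) i j)
  by (extensionality q; now rewrite axialE).
destruct i, j; simpl; try apply partial_const; try reflexivity;
  apply (partial_opp l (fun q => b q _)).
Qed.

Lemma smooth_axial (b : one_form) : smooth_form b -> smooth_tensor2 (axial b).
Proof.
intros sb i j.
replace (fun q => axial b q i j) with (fun q => axial_coef (b q) i j)
  by (extensionality q; now rewrite axialE).
destruct i, j; simpl; try apply smooth_const; try apply sb;
  apply (smooth_opp (fun q => b q _)), sb.
Qed.

Lemma antisymmetric_axial (b : one_form) : antisymmetric (axial b).
Proof. intros p i j; rewrite !axialE; destruct i, j; simpl; ring. Qed.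

(** The triple product [b . (b x c)] is zero; for [b = d f] this is the Casimir property. *)
Lemma sharp_axial_self (b : one_form) (p : R3) (i : coord) :
  sharp (axial b) b p i = 0.
Proof.
rewrite sharp_sum3; unfold sum3; rewrite !axialE; destruct i; simpl; ring.
Qed.

(** * Compatibility as a system of equations on the 1-form [b] *)

Definition rot (b : one_form) (p : R3) (j k : coord) : R :=
  partial j (fun q => b q k) p - partial k (fun q => b q j) p.

Definition gradient_defect (b : one_form) (p : R3) (k : coord) : R :=
  2 * sum3 (fun i => b p i * partial k (fun q => b q i) p)
  - sum3 (fun i => partial i (fun q => b q i) p) * b p k.

Lemma cov_deriv_coef_axial (b : one_form) (p : R3) (i j k : coord) :
  cov_deriv_coef (axial b) p i j k
  = b p j * rot b p i k - b p k * rot b p i j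
    + (kron i j * gradient_defect b p k - kron i k * gradient_defect b p j) / 2.
Proof.
unfold cov_deriv_coef, christoffel, rot, gradient_defect, sum3.
rewrite !partial_axial, !axialE.
destruct i, j, k; simpl; field.
Qed.

(** Linear algebra at one point, for an arbitrary [G]. Once the indices [j], [k] are dualised to a
    single one, the part of the equations containing [G] is antisymmetric, so it drops out of
    symmetrised combinations and of the trace. *)
Lemma norm2_mul_rot_eq0 (u G : coord -> R) (W : coord -> coord -> R) :
  (forall j k, W j k = - W k j) ->
  (forall i j k, u j * W i k - u k * W i j
                 + (kron i j * G k - kron i k * G j) / 2 = 0) ->
  forall j k, sum3 (fun i => u i * u i) * W j k = 0.
Proof.
intros aW.
set (C := fun i j k => u j * W i k - u k * W i j
                       + (kron i j * G k - kron i k * G j) / 2).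
change ((forall i j k, C i j k = 0) ->
        forall j k, sum3 (fun i => u i * u i) * W j k = 0).
intros C0.
assert (W0 : forall j, W j j = 0) by (intros j; assert (H := aW j j); lra).
(* With [E i m] the dual of [C i] and [w] the dual of [W],
   [|u|^2 w m = sum_i u i (E i m + E m i) - u m (tr E) / 2]. *)
assert (Wx : sum3 (fun i => u i * u i) * W cy cz = 0).
  transitivity (u cx * (2 * C cx cy cz) + u cy * (C cy cy cz + C cx cz cx)
    + u cz * (C cz cy cz + C cx cx cy)
    - u cx / 2 * (C cx cy cz + C cy cz cx + C cz cx cy)).
    unfold C, sum3, kron; rewrite !W0.
    rewrite (aW cy cx), (aW cz cx), (aW cz cy); field.
  rewrite !C0; ring.
assert (Wy : sum3 (fun i => u i * u i) * W cx cz = 0).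
  transitivity (- (u cy * (2 * C cy cz cx) + u cx * (C cy cy cz + C cx cz cx)
    + u cz * (C cz cz cx + C cy cx cy)
    - u cy / 2 * (C cx cy cz + C cy cz cx + C cz cx cy))).
    unfold C, sum3, kron; rewrite !W0.
    rewrite (aW cy cx), (aW cz cx), (aW cz cy); field.
  rewrite !C0; ring.
assert (Wz : sum3 (fun i => u i * u i) * W cx cy = 0).
  transitivity (u cz * (2 * C cz cx cy) + u cx * (C cz cy cz + C cx cx cy)
    + u cy * (C cz cz cx + C cy cx cy)
    - u cz / 2 * (C cx cy cz + C cy cz cx + C cz cx cy)).
    unfold C, sum3, kron; rewrite !W0.
    rewrite (aW cy cx), (aW cz cx), (aW cz cy); field.
  rewrite !C0; ring.
intros [] []; rewrite ?W0, ?(aW cy cx), ?(aW cz cx), ?(aW cz cy); lra.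
Qed.

Lemma partial_locally_zero (i : coord) (F : scalar_field) (p : R3) :
  locally p (fun q => F q = 0) -> partial i F p = 0.
Proof.
intros F0; rewrite <- (partial_const i 0 p); apply Derive_ext_loc.
assert (c : continuous (fun t => upd i p t) (proj i p)).
  apply continuous_upd; [apply continuous_const|apply continuous_id].
apply (c (fun q => F q = 0)); now rewrite upd_proj.
Qed.

(* At a point where [rot b] is nonzero it is nonzero on a neighbourhood, on which
   [b] therefore vanishes, and then so does [rot b]. *)
Lemma rot_eq0 (b : one_form) :
  smooth_form b ->
  (forall p j k, sum3 (fun i => b p i * b p i) * rot b p j k = 0) ->
  forall p j k, rot b p j k = 0.
Proof.
intros sb H p j k.
destruct (Req_dec (rot b p j k) 0) as [|nz]; trivial.
assert (cr : continuous (fun q => rot b q j k) p).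
  apply smooth_continuous; unfold rot.
  apply smooth_plus; [|apply smooth_opp]; apply smooth_partial, sb.
assert (b0 : locally p (fun q => forall i, b q i = 0)).
  assert (nzr : locally p (fun q => rot b q j k <> 0)).
    apply (cr (fun r => r <> 0)); exact (open_neq 0 (rot b p j k) nz).
  apply filter_imp with (2 := nzr); intros q nzq i.
  destruct (Rmult_integral _ _ (H q j k)) as [n0|]; [|now contradict nzq].
  unfold sum3 in n0.
  assert (Rx := Rle_0_sqr (b q cx)); assert (Ry := Rle_0_sqr (b q cy)).
  assert (Rz := Rle_0_sqr (b q cz)); unfold Rsqr in *.
  destruct i; apply Rsqr_0_uniq; unfold Rsqr; lra.
assert (P0 : forall l m, partial l (fun q => b q m) p = 0).
  intros l m; apply partial_locally_zero.
  now apply filter_imp with (2 := b0).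
unfold rot; rewrite !P0; ring.
Qed.

(** The equations first force [rot b] to vanish; only the terms in [gradient_defect b] then remain.
    The converse is substitution. *)
Lemma compatible_axial (b : one_form) :
  smooth_form b ->
  compatible (axial b) canonical_metric <->
  (forall p j k, rot b p j k = 0) /\ (forall p k, gradient_defect b p k = 0).
Proof.
intros sb.
rewrite compatible_canonical by auto using smooth_axial, antisymmetric_axial.
split.
  intros C0.
  assert (r0 : forall p j k, rot b p j k = 0).
    apply rot_eq0; trivial; intros p.
    apply norm2_mul_rot_eq0 with (G := gradient_defect b p).
      intros j k; unfold rot; ring.
    now intros i j k; rewrite <- cov_deriv_coef_axial.
  split; trivial; intros p k.
  (* For [i] different from [k], the coefficient of indices [i], [i], [k] reduces to half of
     [gradient_defect b p k]. *)
  assert (i : exists i, i <> k) by (destruct k; [exists cy|exists cx..]; easy).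
  destruct i as [i ik]; assert (H := C0 p i i k).
  rewrite cov_deriv_coef_axial, !r0 in H.
  destruct i, k; simpl in H; try easy; lra.
intros [r0 g0] p i j k.
rewrite cov_deriv_coef_axial, !r0, !g0; field.
Qed.

(** The metric has constant components, so differentiating the square norm of [d f] gives the first
    sum, and the divergence of [d f] is the Laplacian. *)
Lemma gradient_defect_d (f : scalar_field) (p : R3) (i : coord) :
  smooth f ->
  gradient_defect (d f) p i
  = d (eval2 canonical_metric (d f) (d f)) p i - laplacian f p * d f p i.
Proof.
intros sf.
assert (sd : smooth_form (d f)) by (intros j; now apply (smooth_partial j f)).
assert (E : d (eval2 canonical_metric (d f) (d f)) p i
  = deriv_along (partial_field i) (eval2 canonical_metric (d f) (d f)) p)
  by now rewrite deriv_along_partial_field.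
rewrite E, deriv_along_canonical by trivial.
unfold gradient_defect, laplacian, sum3; rewrite !deriv_along_partial_field.
change (fun q => d f q ?j) with (partial j f); unfold d; ring.
Qed.

Lemma bivector_axial_d (p12 p13 p23 f : scalar_field) :
  (forall p, p12 p = partial cz f p) ->
  (forall p, p13 p = - partial cy f p) ->
  (forall p, p23 p = partial cx f p) ->
  bivector p12 p13 p23 = axial (d f).
Proof.
intros H12 H13 H23; unfold axial, d.
f_equal; extensionality p; auto.
Qed.

Theorem theorem1p1 :
  forall p12 p13 p23 : scalar_field,
  poisson_tensor (bivector p12 p13 p23) ->
  (compatible (bivector p12 p13 p23) canonical_metric <->
   exists f : scalar_field,
     smooth f /\
     (forall p, p12 p = partial cz f p) /\
     (forall p, p13 p = - partial cy f p) /\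
     (forall p, p23 p = partial cx f p) /\
     (forall p i, d (eval2 canonical_metric (d f) (d f)) p i
                  - laplacian f p * d f p i = 0)) /\
  (forall f : scalar_field,
     smooth f ->
     (forall p, p12 p = partial cz f p) ->
     (forall p, p13 p = - partial cy f p) ->
     (forall p, p23 p = partial cx f p) ->
     (forall p i, d (eval2 canonical_metric (d f) (d f)) p i
                  - laplacian f p * d f p i = 0) ->
     casimir (bivector p12 p13 p23) f).
Proof.
intros p12 p13 p23 [sT _]; split; [split|].
- intros CT.
  (* The only candidate for [d f], read off from the three equations required of [f]. *)
  pose (b := fun p i => match i with
    | cx => p23 p | cy => - p13 p | cz => p12 p end).
  assert (Tb : bivector p12 p13 p23 = axial b).
    unfold axial; f_equal; extensionality p; simpl; ring.
  rewrite Tb in *.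
  assert (sb : smooth_form b).
    (* The index pairs are cyclic, so that each component of [b] appears in [axial b] with a plus
       sign. *)
    intros i; destruct i.
    + replace (fun q => b q cx) with (fun q => axial b q cy cz); [apply sT|].
      extensionality q; apply axialE.
    + replace (fun q => b q cy) with (fun q => axial b q cz cx); [apply sT|].
      extensionality q; apply axialE.
    + replace (fun q => b q cz) with (fun q => axial b q cx cy); [apply sT|].
      extensionality q; apply axialE.
  apply compatible_axial in CT; trivial; destruct CT as [r0 g0].
  destruct (poincare b sb) as [f [sf dfb]].
    intros i j p; assert (H := r0 p i j); unfold rot in H; lra.
  assert (Eb : d f = b) by (extensionality p; extensionality i; apply dfb).
  exists f; split; [exact sf|repeat split; intros p].
  + symmetry; exact (dfb p cz).
  + change (p13 p = - d f p cy); rewrite dfb; simpl; ring.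
  + symmetry; exact (dfb p cx).
  + intros i; rewrite <- gradient_defect_d, Eb; auto.
- intros [f [sf [H12 [H13 [H23 Hf]]]]].
  rewrite (bivector_axial_d p12 p13 p23 f) by trivial.
  apply compatible_axial; [intros j; now apply (smooth_partial j f)|split].
    (* An exact form is closed, by the symmetry of second derivatives. *)
    intros p j k; unfold rot.
    change (partial j (partial k f) p - partial k (partial j f) p = 0).
    rewrite partial_comm by trivial; ring.
  now intros p k; rewrite gradient_defect_d.
- intros f sf H12 H13 H23 _ p i.
  rewrite (bivector_axial_d p12 p13 p23 f) by trivial.
  apply sharp_axial_self.
Qed.
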